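(* Let $L\ge 1$ and let $n_0,n_1,\dots,n_L\ge 1$ be integers. Let $W_\ell\in\mathbb{R}^{n_\ell\times n_{\ell-1}}$, $1\le \ell\le L$, be the weight matrices of a deep linear network (no biases, all activation functions equal to the identity), and assume every weight matrix is row-orthogonal: $W_\ell W_\ell^\top = I_{n_\ell}$ for all $1\le\ell\le L$. Let $x\in\mathbb{R}^{n_0}$ be an input, let $\mathcal{L}:\mathbb{R}^{n_L}\to\mathbb{R}$ be a differentiable loss function of the network output (the target being fixed), and let $\eta>0$ be a learning rate. Let $\delta W_\ell^{FO}$ be the FOTON (forward-only) updates, computed with the perfectly aligned error-projection matrix $F = W_1^\top W_2^\top\cdots W_L^\top$, and let $\delta W_\ell^{BP}$ be the backpropagation updates, both as defined in the context. Then FOTON exactly matches backpropagation: $$\delta W_\ell^{FO} = \delta W_\ell^{BP} = -\eta\,\frac{\partial \mathcal{L}}{\partial W_\ell}\qquad\text{for all } \ell=1,\dots,L,$$ where $\frac{\partial \mathcal{L}}{\partial W_\ell}\in\mathbb{R}^{n_\ell\times n_{\ell-1}}$ is the matrix of partial derivatives, with respect to the entries of $W_\ell$, of the function $(W_1,\dots,W_L)\mapsto \mathcal{L}(W_L W_{L-1}\cdots W_1 x)$ on $\prod_{\ell=1}^{L}\mathbb{R}^{n_\ell\times n_{\ell-1}}$ (unconstrained, i.e. the Euclidean gradient), evaluated at the given weights.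
   Context: Forward pass (linear network): $h_0=x$, $h_\ell = a_\ell = W_\ell h_{\ell-1}$ for $1\le \ell\le L$, and the prediction is $\hat y = a_L$. The error is $e=\nabla\mathcal{L}(\hat y)\in\mathbb{R}^{n_L}$, the gradient of the loss with respect to the network output. Backpropagation updates: $\delta a_L^{BP}=e$ and $\delta a_\ell^{BP} = W_{\ell+1}^\top\,\delta a_{\ell+1}^{BP}$ for $\ell<L$ (so $\delta a_\ell^{BP}=W_{\ell+1}^\top W_{\ell+2}^\top\cdots W_L^\top e$); $\delta W_\ell^{BP} = -\eta\,\delta a_\ell^{BP}\,h_{\ell-1}^\top$ for $1\le\ell<L$ and $\delta W_L^{BP}=-\eta\, e\, h_{L-1}^\top$. FOTON updates: a second, modulated forward pass is performed on the perturbed input $x-Fe$, where $F\in\mathbb{R}^{n_0\times n_L}$ is $F=W_1^\top W_2^\top\cdots W_L^\top$: $h_0^{err}=x-Fe$, $h_\ell^{err}=a_\ell^{err}=W_\ell h_{\ell-1}^{err}$ for $1\le\ell\le L$, where $e$ is the error computed in the first forward pass. Then $\delta W_\ell^{FO} = -\eta\,(h_\ell-h_\ell^{err})\,h_{\ell-1}^\top$ for $1\le\ell<L$, and $\delta W_L^{FO}=-\eta\, e\, h_{L-1}^\top$. *)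

(* Defs.v *)
From HB Require Import structures.
From mathcomp Require Import all_boot all_order all_algebra.
From mathcomp Require Import all_classical all_reals all_analysis.

Set Implicit Arguments.
Unset Strict Implicit.
Unset Printing Implicit Defensive.

Import Order.TTheory GRing.Theory Num.Theory numFieldNormedType.Exports.

Local Open Scope ring_scope.

(* The Euclidean gradient, stored with the shape of the argument (column
   vectors are the case k = 1).  ['D_v f A] is the library's total directional
   derivative, so this is the matrix of partial derivatives of f where these
   exist; it is only used on functions differentiable at A. *)
Definition gradient (R : realType) (m k : nat) (f : 'M[R]_(m, k) -> R)
    (A : 'M[R]_(m, k)) : 'M[R]_(m, k) :=
  \matrix_(i < m, j < k) 'D_(delta_mx i j) f A.

(* A linear network has layer widths [n 0, n 1, ...] and weights counted from 0:
   [W l : 'M_(n l.+1, n l)] is the matrix W_{l+1} of the usual 1-based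
   numbering, mapping layer l to layer l.+1.  A network of depth L only uses
   [W l] for l < L and [n l] for l <= L; the rest of the sequences is
   irrelevant padding. *)
Section LinearNetwork.
Variables (R : realType) (n : nat -> nat).
Implicit Types (W : forall l, 'M[R]_(n l.+1, n l)) (L l : nat) (eta : R).

Fixpoint forward W (x : 'cV[R]_(n 0%N)) l : 'cV[R]_(n l) :=
  match l with
  | 0 => x
  | l'.+1 => W l' *m forward W x l'
  end.

(* [eqtype.dfwith f v] is the family f with one entry overridden by v, the index
   being read off the type of v (qualified, as classical/mathcomp_extra has a
   homonym).  Here entry L is e, and the lower ones are obtained by propagating
   W_L^T e down from layer L - 1 (see the two lemmas below).  The entries above
   L are 0. *)
Fixpoint bp_delta W L : 'cV[R]_(n L) -> forall l, 'cV[R]_(n l) :=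
  match L return 'cV[R]_(n L) -> forall l, 'cV[R]_(n l) with
  | 0 => fun e => eqtype.dfwith (fun l => 0 : 'cV[R]_(n l)) e
  | L'.+1 => fun e => eqtype.dfwith (@bp_delta W L' ((W L')^T *m e)) e
  end.

Lemma bp_delta_last W L (e : 'cV[R]_(n L)) : bp_delta W e L = e.
Proof. by case: L e => [|L] e /=; rewrite dfwith_in. Qed.

Lemma bp_delta_rec W L (e : 'cV[R]_(n L)) l : (l < L)%N ->
  bp_delta W e l = (W l)^T *m bp_delta W e l.+1.
Proof.
elim: L e => // L IH e; rewrite ltnS leq_eqVlt => /predU1P[->|lL] /=.
  by rewrite dfwith_in dfwith_out ?bp_delta_last// gtn_eqF.
by rewrite !dfwith_out ?IH// gtn_eqF// ltnS// ltnW.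
Qed.

Definition bp_update W L (x : 'cV[R]_(n 0%N)) (e : 'cV[R]_(n L)) eta l :
    'M[R]_(n l.+1, n l) :=
  - eta *: (bp_delta W e l.+1 *m (forward W x l)^T).

(* W_1^T W_2^T ... W_L^T *)
Fixpoint foton_proj W L : 'M[R]_(n 0%N, n L) :=
  match L with
  | 0 => 1%:M
  | L'.+1 => foton_proj W L' *m (W L')^T
  end.

Definition foton_forward W L (x : 'cV[R]_(n 0%N)) (e : 'cV[R]_(n L)) :
    forall l, 'cV[R]_(n l) :=
  forward W (x - foton_proj W L *m e).

(* The signal h_l - h_l^err, replaced by the error e itself at the output
   layer L. *)
Definition foton_delta W L (x : 'cV[R]_(n 0%N)) (e : 'cV[R]_(n L)) :
    forall l, 'cV[R]_(n l) :=
  eqtype.dfwith (fun l => forward W x l - foton_forward W x e l) e.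

Definition foton_update W L (x : 'cV[R]_(n 0%N)) (e : 'cV[R]_(n L)) eta l :
    'M[R]_(n l.+1, n l) :=
  - eta *: (foton_delta W x e l.+1 *m (forward W x l)^T).

(* The gradient with respect to the single weight [W l], all the other weights
   being held fixed, of the loss of the output of the depth-L network. *)
Definition weight_gradient W L (loss : 'cV[R]_(n L) -> R) (x : 'cV[R]_(n 0%N)) l :
    'M[R]_(n l.+1, n l) :=
  gradient
    (fun M : 'M[R]_(n l.+1, n l) =>
       loss (forward (@eqtype.dfwith _ (fun k => 'M[R]_(n k.+1, n k)) W l M) x L))
    (W l).

End LinearNetwork.

(* Main.v *)
Require Import Defs.
From HB Require Import structures.
From mathcomp Require Import all_boot all_order all_algebra.
From mathcomp Require Import all_classical all_reals all_analysis.
Import Order.TTheory GRing.Theory Num.Theory numFieldNormedType.Exports.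
Local Open Scope ring_scope.

(* FOTON = BP: row-orthogonality makes the forward pass undo backpropagation:
   F e is the backpropagated error at the input layer, and
   W_l (W_l^T d) = d moves it back up through the layers, so by linearity
   h_l - h_l^err is the backpropagated error at layer l.  BP = gradient: the
   network output depends on W_l through W_l |-> P W_l h_{l-1} with P the product
   of the later weights, and the backpropagated error at layer l is P^T e. *)

(** Places the given network in the family with entry [l] replaced by [M], at [M = W l]. *)
Lemma dfwith_id (I : eqType) (T : I -> Type) (f : forall i, T i) (i : I) :
  eqtype.dfwith f (f i) = f.
Proof.
apply: functional_extensionality_dep => j.
by have [<-|ij] := eqVneq i j; rewrite (dfwith_in, dfwith_out).
Qed.

Section Network.
Variables (R : realType) (n : nat -> nat).
Implicit Types W : forall l, 'M[R]_(n l.+1, n l).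

Lemma forwardB W (x y : 'cV[R]_(n 0%N)) l :
  forward W (x - y) l = forward W x l - forward W y l.
Proof. by elim: l => //= l ->; rewrite mulmxBr. Qed.

Lemma foton_proj_bp_delta W L (e : 'cV[R]_(n L)) :
  foton_proj W L *m e = bp_delta W e 0%N.
Proof.
elim: L e => [|L IH] e /=; first by rewrite dfwith_in mul1mx.
by rewrite dfwith_out// -mulmxA IH.
Qed.

Lemma forward_bp_delta W L (e : 'cV[R]_(n L)) l :
  (forall k, (k < L)%N -> W k *m (W k)^T = 1%:M) -> (l <= L)%N ->
  forward W (bp_delta W e 0%N) l = bp_delta W e l.
Proof.
move=> WWT; elim: l => //= l IH lL.
by rewrite IH 1?ltnW// (bp_delta_rec _ _ lL) mulmxA WWT// mul1mx.
Qed.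

Lemma foton_delta_bp_delta W L (x : 'cV[R]_(n 0%N)) (e : 'cV[R]_(n L)) l :
  (forall k, (k < L)%N -> W k *m (W k)^T = 1%:M) -> (l <= L)%N ->
  foton_delta W x e l = bp_delta W e l.
Proof.
move=> WWT; rewrite leq_eqVlt => /predU1P[->|lL].
  by rewrite /foton_delta dfwith_in bp_delta_last.
(* By linearity [subKr] cancels the pass on [x], leaving the pass on [F e]. *)
rewrite /foton_delta dfwith_out ?gtn_eqF// /foton_forward forwardB subKr.
by rewrite foton_proj_bp_delta forward_bp_delta// ltnW.
Qed.

(** Layer [k] reads only the weights of index below [k], so even layer [l] does not see [M]. *)
Lemma forward_dfwith_below W (x : 'cV[R]_(n 0%N)) l (M : 'M[R]_(n l.+1, n l)) k :
  (k <= l)%N ->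
  forward (@eqtype.dfwith _ (fun k => 'M[R]_(n k.+1, n k)) W l M) x k =
  forward W x k.
Proof. by elim: k => //= k IH kl; rewrite dfwith_out ?gtn_eqF// IH// ltnW. Qed.

(** [P] is the product of the weights of index [L - 1] down to [l + 1], built by induction on [L]
    from the empty product at [L = l + 1]. It depends on neither [M] nor [e]. *)
Lemma forward_dfwith_above W (x : 'cV[R]_(n 0%N)) l L : (l < L)%N ->
  exists P : 'M[R]_(n L, n l.+1),
    (forall M : 'M[R]_(n l.+1, n l),
      forward (@eqtype.dfwith _ (fun k => 'M[R]_(n k.+1, n k)) W l M) x L =
      P *m (M *m forward W x l)) /\
    (forall e : 'cV[R]_(n L), bp_delta W e l.+1 = P^T *m e).
Proof.
elim: L => // L IH; rewrite ltnS leq_eqVlt => /predU1P[->|lL].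
  exists 1%:M; split=> [M|e]; last by rewrite bp_delta_last trmx1 mul1mx.
  by rewrite mul1mx /= dfwith_in forward_dfwith_below.
have [P [PM Pe]] := IH lL; exists (W L *m P); split=> [M|e] /=.
  by rewrite PM dfwith_out ?ltn_eqF// mulmxA.
by rewrite dfwith_out ?gtn_eqF// Pe trmx_mul mulmxA.
Qed.

End Network.

Lemma derive_gradient (R : realType) (m : nat) (f : 'cV[R]_m -> R)
    (y v : 'cV[R]_m) :
  differentiable f y -> 'D_v f y = ((gradient f y)^T *m v) 0 0.
Proof.
(* Differentiability makes the derivative linear in [v], which is expanded in the standard basis. *)
move=> df; rewrite deriveE// [in LHS](matrix_sum_delta v) linear_sum mxE.
apply: eq_bigr => i _; rewrite big_ord1 linearZ/= !mxE deriveE//.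
by rewrite mulrC.
Qed.

Lemma weight_gradientE (R : realType) (n : nat -> nat)
    (W : forall l : nat, 'M[R]_(n l.+1, n l)) (L : nat)
    (loss : 'cV[R]_(n L) -> R) (x : 'cV[R]_(n 0%N)) (l : nat) :
  (l < L)%N -> differentiable loss (forward W x L) ->
  weight_gradient W loss x l =
  bp_delta W (gradient loss (forward W x L)) l.+1 *m (forward W x l)^T.
Proof.
move=> lL dloss.
have [P [PM Pe]] := forward_dfwith_above _ _ W x _ _ lL.
have PW : forward W x L = P *m (W l *m forward W x l).
  by rewrite -PM (@dfwith_id _ (fun k => 'M[R]_(n k.+1, n k))).
apply/matrixP => i j; rewrite mxE.
(* M |-> P M h is linear, so the two difference quotients coincide and no chain
   rule is needed. *)
transitivity ('D_(P *m (delta_mx i j *m forward W x l)) loss (forward W x L)).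
  rewrite /derive; apply: (congr1 (fun F : R -> R => lim (fmap F _))).
  apply/funext => h /=.
  by rewrite !PM PW mulmxDl mulmxDr -scalemxAl -scalemxAr.
rewrite derive_gradient//; set e := gradient loss _.
have {}Pe : e^T *m P = (bp_delta W e l.+1)^T by rewrite Pe trmx_mul trmxK.
(* Splitting [delta_mx i j] as a column times a row factors the scalar into entry [i] of the
   backpropagated error and entry [j] of the layer input. *)
rewrite mulmxA Pe mulmxA -(mul_delta_mx (0 : 'I_1)) mulmxA -colE -mulmxA -rowE.
by rewrite !mxE !big_ord1 !mxE.
Qed.

Theorem theoremB1 (R : realType) (L : nat) (n : nat -> nat)
    (W : forall l : nat, 'M[R]_(n l.+1, n l))
    (x : 'cV[R]_(n 0%N)) (loss : 'cV[R]_(n L) -> R) (eta : R)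
    (L_ge1 : (1 <= L)%N)
    (n_ge1 : forall l : nat, (l <= L)%N -> (1 <= n l)%N)
    (W_row_orthogonal : forall l : nat, (l < L)%N -> W l *m (W l)^T = 1%:M)
    (loss_differentiable : forall y : 'cV[R]_(n L), differentiable loss y)
    (eta_gt0 : 0 < eta) :
  let e := gradient loss (forward W x L) in
  forall l : nat, (l < L)%N ->
    foton_update W x e eta l = bp_update W x e eta l /\
    bp_update W x e eta l = - eta *: weight_gradient W loss x l.
Proof.
move=> e l lL; split.
  by rewrite /foton_update /bp_update foton_delta_bp_delta.
by rewrite weight_gradientE.
Qed.
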